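(* Let $\mathcal{T}=(V,\mathsf{p})$ be a directed forest. Then the following conditions are equivalent: (a) every bounded hyponormal weighted shift on $\mathcal{T}$ is power hyponormal; (b) the square of any bounded hyponormal weighted shift on $\mathcal{T}$ is hyponormal; (c) the leafless support $\mathring{\mathcal{T}}$ of $\mathcal{T}$ is forkless; (d) every leafless directed forest thinner than $\mathcal{T}$ is forkless.
   Context: A directed forest is a pair $\mathcal{T}=(V,\mathsf{p})$ where $V$ is a nonempty set and $\mathsf{p}\colon V\to V$ satisfies: if $n\in\mathbb{N}$, $v\in V$ and $\mathsf{p}^n(v)=v$, then $\mathsf{p}(v)=v$. The roots are $\mathrm{root}(\mathcal{T})=\{v\in V:\mathsf{p}(v)=v\}$, and $V^\circ=V\setminus\mathrm{root}(\mathcal{T})$. The children of $v$ are $\mathrm{Chi}(v)=\{u\in V:\mathsf{p}(u)=v\neq u\}$ and $\deg(v)$ is the cardinality of $\mathrm{Chi}(v)$. A leaf is an element of $V\setminus\mathsf{p}(V)$; $\mathcal{T}$ is leafless if $\mathsf{p}(V)=V$. $\mathcal{T}$ is forkless if $\deg(v)=1$ for every $v\in V^\circ$. For directed forests $\mathcal{T}_1=(V,\mathsf{p}_1)$, $\mathcal{T}_2=(V,\mathsf{p}_2)$ on the same vertex set, $\mathcal{T}_1$ is thinner than $\mathcal{T}_2$ if $\mathsf{p}_1(v)\in\{v,\mathsf{p}_2(v)\}$ for every $v\in V$. The leafless support $\mathring{\mathcal{T}}$ of $\mathcal{T}$ is the thickest (greatest with respect to ''thinner than'') leafless directed forest on $V$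 thinner than $\mathcal{T}$ (such a greatest element exists). A system of weights on $\mathcal{T}$ is a family ${\boldsymbol\lambda}=\{\lambda_v\}_{v\in V}\subseteq\mathbb{C}$ with $\lambda_\omega=0$ for all roots $\omega$; the weighted shift $S_{\boldsymbol\lambda}$ on $\mathcal{T}$ is the operator in $\ell^2(V)$ with domain $\{f\in\ell^2(V):\Gamma_{\boldsymbol\lambda}(f)\in\ell^2(V)\}$ and $S_{\boldsymbol\lambda}f=\Gamma_{\boldsymbol\lambda}(f)$, where $\Gamma_{\boldsymbol\lambda}(f)(v)=\lambda_v f(\mathsf{p}(v))$. A bounded operator $T$ on a Hilbert space is hyponormal if $T^*T-TT^*\geq 0$, and power hyponormal if $T^n$ is hyponormal for every $n\geq1$. *)

(* Defs.v *)
From HB Require Import structures.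
From mathcomp Require Import all_boot all_order all_algebra.
From mathcomp Require Import all_classical all_reals.
From mathcomp Require Import topology normedtype sequences esum.
From mathcomp Require Import complex.

Set Implicit Arguments.
Unset Strict Implicit.
Unset Printing Implicit Defensive.

Import Order.TTheory GRing.Theory Num.Theory.
Local Open Scope classical_set_scope.
Local Open Scope ring_scope.

Section Forest.
Variable V : Type.
Implicit Types p q : V -> V.

Definition directed_forest p : Prop :=
  forall (n : nat) (v : V), iter n.+1 p v = v -> p v = v.

Definition is_root p (v : V) : Prop := p v = v.

Definition Chi p (v : V) : set V := [set u | p u = v /\ v <> u].

Definition forkless p : Prop :=
  forall v, ~ is_root p v -> exists u, Chi p v = [set u].

Definition leafless p : Prop := forall v, exists u, p u = v.

Definition thinner p1 p2 : Prop := forall v, p1 v = v \/ p1 v = p2 v.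

Definition leafless_support p q : Prop :=
  [/\ directed_forest q, leafless q, thinner q p &
      forall r, directed_forest r -> leafless r -> thinner r p -> thinner r q].

End Forest.

Section L2.
Variables (R : realType) (V : choiceType).
Local Notation C := R[i].

Definition sqnorm (f : V -> C) : \bar R :=
  (\esum_(v in [set: V]) ((Normc.normc (f v)) ^+ 2)%:E)%E.

Definition l2 (f : V -> C) : Prop := (sqnorm f < +oo)%E.

(* sum of an absolutely summable real family: positive part minus negative part *)
Definition rsum (a : V -> R) : R :=
  fine (\esum_(v in [set: V]) (Num.max (a v) 0)%:E)%E
  - fine (\esum_(v in [set: V]) (Num.max (- a v) 0)%:E)%E.

Definition inner (f g : V -> C) : C :=
  Complex (rsum (fun v => @complex.Re R (f v * conjc (g v))))
          (rsum (fun v => @complex.Im R (f v * conjc (g v)))).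

(* operators are represented by their action on functions V -> C;
   only their restriction to l^2(V) matters *)
Definition bounded_op (T : (V -> C) -> (V -> C)) : Prop :=
  exists c : R, forall f, l2 f -> l2 (T f) /\ (sqnorm (T f) <= c%:E * sqnorm f)%E.

Definition is_adjoint (T A : (V -> C) -> (V -> C)) : Prop :=
  (forall g, l2 g -> l2 (A g)) /\
  forall f g, l2 f -> l2 g -> inner (T f) g = inner f (A g).

Definition hyponormal (T : (V -> C) -> (V -> C)) : Prop :=
  exists A, is_adjoint T A /\
    forall f, l2 f -> 0 <= inner (A (T f)) f - inner (T (A f)) f.

Definition power_hyponormal (T : (V -> C) -> (V -> C)) : Prop :=
  forall n : nat, (1 <= n)%N -> hyponormal (iter n T).

End L2.

Section Shift.
Variables (R : realType) (V : choiceType).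
Local Notation C := R[i].

Definition weight_system (p : V -> V) (lam : V -> C) : Prop :=
  forall w, is_root p w -> lam w = 0.

Definition Gamma (p : V -> V) (lam : V -> C) (f : V -> C) : V -> C :=
  fun v => lam v * f (p v).

End Shift.

(* Main.v *)
(* For u in V put d(u) = |S e_u|^2, the sum of |lambda_v|^2 over p(v) = u. A
   bounded weighted shift S is hyponormal iff d(v) > 0 whenever lambda_v <> 0
   and, for every u, the sum of |lambda_v|^2 / d(v) over p(v) = u is at most 1.
   Necessity follows by testing |S* f| <= |S f| on f = lambda / d restricted to
   finite sets of siblings; sufficiency follows from Young's inequality applied
   to |S* f|^2 = <S S* f, f>.

   If S is hyponormal, every v with lambda_v <> 0 has a child w with
   lambda_w <> 0, so the support of lambda spans a leafless forest. When that
   forest is forkless, the moduli |lambda| increase along its branches, and the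
   criterion for S^n at u reduces to the one for S at u.

   Conversely, at a fork v of a leafless forest q, let lambda be supported on v
   and two infinite branches starting at children u1, u2 of v. Suitable weights
   make S hyponormal while |S^2 e_{u1}| < |lambda_{u1} lambda_v|, so S^2 is not
   hyponormal. *)
Require Import Defs.
From HB Require Import structures.
From mathcomp Require Import all_boot all_order all_algebra.
From mathcomp Require Import all_classical all_reals.
From mathcomp Require Import topology normedtype sequences esum.
From mathcomp Require Import ereal numfun.
From mathcomp Require Import complex.
From mathcomp Require Import ring lra.

Set Implicit Arguments.
Unset Strict Implicit.
Unset Printing Implicit Defensive.

Import Order.TTheory GRing.Theory Num.Theory.
Local Open Scope classical_set_scope.
Local Open Scope ring_scope.
Local Notation "x %:C" := (real_complex _ x) : ring_scope.

(** * Sums of extended-real and real families over the vertices *)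

Section Sums.
Variables (R : realType) (V : choiceType).
Implicit Types (a b P N : V -> R) (p : V -> V).

Definition total a : \bar R := (\esum_(v in [set: V]) (a v)%:E)%E.

Definition abs_summable a : Prop := (total (fun v => `|a v|%R) < +oo)%E.

Lemma total_ge0 a : (forall v, 0 <= a v) -> (0 <= total a)%E.
Proof. by move=> a0; apply: esum_ge0 => v _; rewrite lee_fin. Qed.

Lemma le_total a b : (forall v, a v <= b v) -> (total a <= total b)%E.
Proof. by move=> ab; apply: le_esum => v _; rewrite lee_fin. Qed.

Lemma totalD a b : (forall v, 0 <= a v) -> (forall v, 0 <= b v) ->
  total (fun v => a v + b v) = (total a + total b)%E.
Proof. by move=> a0 b0; rewrite -esumD// => v _; rewrite lee_fin. Qed.

Lemma esumZl (D : set V) (k : R) (x : V -> \bar R) :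
  0 <= k -> (forall v, (0 <= x v)%E) ->
  (\esum_(v in D) (k%:E * x v) = k%:E * \esum_(v in D) x v)%E.
Proof.
(* Pulling a scalar out of a supremum requires a nonempty set of partial sums; the empty sum
   provides one. *)
move=> k0 x0; rewrite [X in (_ * X)%E]/esum -ereal_supZl//; last first.
  apply/set0P; exists (\sum_(v \in set0) x v)%E => /=.
  by exists set0 => //; split => //; exact: finite_set0.
congr ereal_sup; apply/seteqP; split => [_ [A FA <-]|_ [_ [A FA <-] <-]] /=.
  exists (\sum_(v \in A) x v)%E; first by exists A.
  by rewrite ge0_mule_fsumr.
by exists A => //; rewrite ge0_mule_fsumr.
Qed.

Lemma totalZ k a : 0 <= k -> (forall v, 0 <= a v) ->
  total (fun v => k * a v) = (k%:E * total a)%E.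
Proof. by move=> k0 a0; rewrite -esumZl. Qed.

Lemma total_fineK a : (forall v, 0 <= a v) -> (total a < +oo)%E ->
  (fine (total a))%:E = total a.
Proof. by move=> a0 aoo; rewrite fineK// ge0_fin_numE// total_ge0. Qed.

Lemma abs_summable_ge0 a : (forall v, 0 <= a v) -> (total a < +oo)%E ->
  abs_summable a.
Proof. by move=> a0; apply: le_lt_trans; apply: le_total => v; rewrite ger0_norm. Qed.

Lemma abs_summable_le a b : (forall v, `|a v| <= b v) -> (total b < +oo)%E ->
  abs_summable a.
Proof. by move=> ab; apply: le_lt_trans; exact: le_total. Qed.

Lemma abs_summable_pos a : abs_summable a -> (total (fun v => Num.max (a v) 0)%R < +oo)%E.
Proof.
by apply: le_lt_trans; apply: le_total => v; rewrite ge_max normr_ge0 ler_norm.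
Qed.

Lemma abs_summable_neg a :
  abs_summable a -> (total (fun v => Num.max (- a v) 0)%R < +oo)%E.
Proof.
by apply: le_lt_trans; apply: le_total => v; rewrite ge_max normr_ge0 -normrN ler_norm.
Qed.

Lemma abs_summableZ k a : abs_summable a -> abs_summable (fun v => k * a v).
Proof.
move=> aS; apply: (@abs_summable_le _ (fun v => `|k| * `|a v|)) => [v|].
  by rewrite normrM.
by rewrite totalZ// lte_mul_pinfty// lee_fin.
Qed.

(** [rsum] is built from the canonical positive and negative parts. Any other splitting into
    nonnegative summable families gives the same value, and additivity and homogeneity reduce to
    this. *)
Lemma rsum_sub P N : (forall v, 0 <= P v) -> (forall v, 0 <= N v) ->
  (total P < +oo)%E -> (total N < +oo)%E ->
  rsum (fun v => P v - N v) = fine (total P) - fine (total N).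
Proof.
move=> P0 N0 Poo Noo.
have PS : summable [set: V] (EFin \o P) by exact: abs_summable_ge0.
have NS : summable [set: V] (EFin \o N) by exact: abs_summable_ge0.
have aS : abs_summable (fun v => P v - N v).
  apply: (@abs_summable_le _ (fun v => P v + N v)) => [v|].
    by rewrite (le_trans (ler_normB _ _))// !ger0_norm.
  by rewrite totalD//; apply: lte_add_pinfty.
have E1 : \esum_(i in [set: V]) ((EFin \o P) \- (EFin \o N))^\+%E i =
    total (fun v => Num.max (P v - N v) 0).
  by apply: eq_esum => v _; rewrite funeposE /= -EFinB -EFin_max.
have E2 : \esum_(i in [set: V]) ((EFin \o P) \- (EFin \o N))^\-%E i =
    total (fun v => Num.max (- (P v - N v)) 0).
  by apply: eq_esum => v _; rewrite funenegE /= -EFin_max.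
have H : (total (fun v => Num.max (P v - N v) 0)%R
    - total (fun v => Num.max (- (P v - N v)) 0)%R = total P - total N)%E.
  by rewrite -E1 -E2; apply: (esumB PS NS) => v _; rewrite lee_fin.
move: H.
have m0 a v : 0 <= Num.max (a v) 0 by rewrite le_max lexx orbT.
rewrite -(total_fineK (m0 _) (abs_summable_pos aS)).
rewrite -(total_fineK (m0 (fun v => - (P v - N v))) (abs_summable_neg aS)).
by rewrite -(total_fineK P0 Poo) -(total_fineK N0 Noo) -!EFinB => -[].
Qed.

Lemma max0_ge0 (x : R) : 0 <= Num.max x 0. Proof. by rewrite le_max lexx orbT. Qed.

Lemma max0_sub (x : R) : Num.max x 0 - Num.max (- x) 0 = x.
Proof. by case: (leP x 0) => x0; case: (leP (- x) 0) => x1; lra. Qed.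

Lemma eq_rsum a b : a =1 b -> rsum a = rsum b.
Proof. by move=> /funext ->. Qed.

Lemma rsumN a : rsum (fun v => - a v) = - rsum a.
Proof.
rewrite /rsum opprB; congr (_ - fine _).
by apply: eq_esum => v _; rewrite opprK.
Qed.

Lemma rsum_ge0E a : (forall v, 0 <= a v) -> rsum a = fine (total a).
Proof.
move=> a0; rewrite /rsum [X in _ - fine X]esum1 ?subr0 => [|v _].
  by congr fine; apply: eq_esum => v _; rewrite max_l.
by rewrite max_r// oppr_le0.
Qed.

Lemma rsumD a b : abs_summable a -> abs_summable b ->
  rsum (fun v => a v + b v) = rsum a + rsum b.
Proof.
move=> aS bS.
rewrite (@eq_rsum _ (fun v => (Num.max (a v) 0 + Num.max (b v) 0) -
    (Num.max (- a v) 0 + Num.max (- b v) 0))); last first.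
  by move=> v; rewrite opprD addrACA !max0_sub.
have mS c : abs_summable c -> (total (fun v => Num.max (c v) 0)%R < +oo)%E.
  exact: abs_summable_pos.
have nS c : abs_summable c -> (total (fun v => Num.max (- c v) 0)%R < +oo)%E.
  exact: abs_summable_neg.
have m0 (c : V -> R) v : 0 <= Num.max (c v) 0 by exact: max0_ge0.
have n0 (c : V -> R) v : 0 <= Num.max (- c v) 0 by exact: max0_ge0.
rewrite rsum_sub.
- rewrite !totalD// !fineD ?ge0_fin_numE ?total_ge0 ?(mS a aS) ?(mS b bS) ?(nS a aS) ?(nS b bS)//.
  by rewrite /rsum opprD addrACA.
- by move=> v; rewrite addr_ge0.
- by move=> v; rewrite addr_ge0.
- by rewrite totalD//; apply: lte_add_pinfty; exact: mS.
- by rewrite totalD//; apply: lte_add_pinfty; exact: nS.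
Qed.

Lemma rsumZ k a : abs_summable a -> rsum (fun v => k * a v) = k * rsum a.
Proof.
move=> aS; wlog k0 : k / 0 <= k => [H|].
  have [k0|/ltW k0] := leP 0 k; first exact: H.
  rewrite (@eq_rsum _ (fun v => - ((- k) * a v))) ?rsumN => [|v].
    by rewrite H ?oppr_ge0// mulNr opprK.
  by rewrite mulNr opprK.
rewrite (@eq_rsum _ (fun v => k * Num.max (a v) 0 - k * Num.max (- a v) 0)); last first.
  by move=> v; rewrite -mulrBr max0_sub.
have mS := abs_summable_pos aS; have nS := abs_summable_neg aS.
have m0 (c : V -> R) v : 0 <= Num.max (c v) 0 by exact: max0_ge0.
have n0 (c : V -> R) v : 0 <= Num.max (- c v) 0 by exact: max0_ge0.
rewrite rsum_sub ?totalZ//; try by move=> v; rewrite mulr_ge0.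
- rewrite !fineM// ?ge0_fin_numE ?total_ge0//.
  by rewrite -mulrBr /rsum.
- by rewrite lte_mul_pinfty// lee_fin.
- by rewrite lte_mul_pinfty// lee_fin.
Qed.

Lemma rsum_le a b : (forall v, 0 <= b v) -> (forall v, a v <= b v) ->
  (total b < +oo)%E -> rsum a <= fine (total b).
Proof.
move=> b0 ab boo.
have mb : (total (fun v => Num.max (a v) 0)%R <= total b)%E.
  by apply: le_total => v; rewrite ge_max ab b0.
have m0 (c : V -> R) v : 0 <= Num.max (c v) 0 by exact: max0_ge0.
apply: (@le_trans _ _ (fine (total (fun v => Num.max (a v) 0)))).
  (* [fine] sends [+oo] to 0, so the subtracted negative part is nonnegative in every case. *)
  rewrite /rsum gerBl; apply: fine_ge0; apply: esum_ge0 => v _ /=.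
  by rewrite lee_fin max0_ge0.
apply: fine_le => //; rewrite ge0_fin_numE ?total_ge0//.
by apply: le_lt_trans boo.
Qed.

(** The map v |-> (p v, v) is a bijection of [V] onto the pairs (u, v) with v in the fibre over u,
    so this is Fubini for nonnegative terms. *)
Lemma esum_fibers p (x : V -> \bar R) : (forall v, (0 <= x v)%E) ->
  (\esum_(v in [set: V]) x v =
   \esum_(u in [set: V]) \esum_(v in p @^-1` [set u]) x v)%E.
Proof.
move=> x0; rewrite (@esum_esum R V V setT (fun u => p @^-1` [set u]) (fun _ => x))//.
rewrite (reindex_esum [set: V] _ (fun v => (p v, v)))//; split => //=.
- by move=> v v' _ _ [].
- by move=> [u v] [_ /= <-]; exists v.
Qed.

(** Regrouping by parent is applied separately to the positive and negative parts, both of finite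
    total. It yields the adjoint identity of a shift. *)
Lemma rsum_fibers p a : abs_summable a ->
  rsum a = rsum (fun u => rsum (fun v => if p v == u then a v else 0)).
Proof.
move=> aS.
have mS := abs_summable_pos aS; have nS := abs_summable_neg aS.
pose F (c : V -> R) u := (\esum_(v in p @^-1` [set u]) (c v)%:E)%E.
have F0 c u : (forall v, 0 <= c v) -> (0 <= F c u)%E.
  by move=> c0; apply: esum_ge0 => v _; rewrite lee_fin.
have FS c : (forall v, 0 <= c v) -> (total c < +oo)%E ->
    total (fun u => fine (F c u)) = total c.
  move=> c0 coo; rewrite [RHS](esum_fibers p) => [|v]; last by rewrite lee_fin.
  apply: eq_esum => u _; rewrite fineK// ge0_fin_numE ?F0//.
  apply: le_lt_trans coo; rewrite /F esum_mkcond; apply: le_esum => v _.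
  by case: ifP => _ //; rewrite lee_fin.
have m0 (c : V -> R) v : 0 <= Num.max (c v) 0 by exact: max0_ge0.
have n0 (c : V -> R) v : 0 <= Num.max (- c v) 0 by exact: max0_ge0.
rewrite [RHS](@eq_rsum _ (fun u => fine (F (fun v => Num.max (a v) 0) u)
    - fine (F (fun v => Num.max (- a v) 0) u))).
  rewrite rsum_sub ?FS//; by move=> u; apply: fine_ge0; exact: F0.
have inE' u v : (v \in p @^-1` [set u]) = (p v == u).
  by apply/idP/eqP; rewrite inE.
move=> u; rewrite /rsum /F; congr (fine _ - fine _);
  rewrite [RHS]esum_mkcond; apply: eq_esum => v _; rewrite inE';
  by case: ifP => // _; rewrite ?oppr0 maxxx.
Qed.

End Sums.

(** * Complex sums, the inner product and hyponormality on [l2] *)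

Section ComplexSums.
Variables (R : realType) (V : choiceType).
Local Notation C := R[i].
Implicit Types (f g h lam : V -> C) (a : V -> R) (p : V -> V).

Definition nsq (z : C) : R := Normc.normc z ^+ 2.

Lemma nsq_ge0 z : 0 <= nsq z. Proof. exact: sqr_ge0. Qed.
Hint Resolve nsq_ge0 : core.

Lemma nsqE z : nsq z = complex.Re z ^+ 2 + complex.Im z ^+ 2.
Proof. by case: z => x y; rewrite /nsq /= sqr_sqrtr// addr_ge0// sqr_ge0. Qed.

Lemma nsqM z w : nsq (z * w) = nsq z * nsq w.
Proof. by rewrite /nsq Normc.normcM exprMn. Qed.

Lemma nsq_eq0 z : (nsq z == 0) = (z == 0).
Proof.
rewrite /nsq sqrf_eq0; apply/eqP/eqP => [/Normc.eq0_normc//|->].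
exact: Normc.normc0.
Qed.

Lemma nsq0 : nsq 0 = 0. Proof. by apply/eqP; rewrite nsq_eq0. Qed.

Lemma nsq_gt0 z : (0 < nsq z) = (z != 0).
Proof. by rewrite lt0r nsq_eq0 nsq_ge0 andbT. Qed.

Lemma nsq_real (x : R) : nsq x%:C = x ^+ 2.
Proof. by rewrite nsqE /= expr0n addr0. Qed.

Lemma nsqJ z : nsq (conjc z) = nsq z.
Proof. by rewrite !nsqE; case: z => x y /=; rewrite sqrrN. Qed.

Lemma mulJ_nsq z : z * conjc z = (nsq z)%:C.
Proof.
rewrite nsqE; case: z => x y; apply/eqP; rewrite eq_complex /=.
by apply/andP; split; apply/eqP; ring.
Qed.

Lemma le_absRe_nsq z w :
  `|complex.Re (z * conjc w)| <= nsq z + nsq w.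
Proof.
rewrite !nsqE; case: z w => x y [x' y'] /=; rewrite ler_norml.
have := (sqr_ge0 (x + x'), sqr_ge0 (x - x'), sqr_ge0 (y + y'), sqr_ge0 (y - y')).
by move=> [[[? ?] ?] ?]; apply/andP; split; nra.
Qed.

Lemma le_absIm_nsq z w :
  `|complex.Im (z * conjc w)| <= nsq z + nsq w.
Proof.
rewrite !nsqE; case: z w => x y [x' y'] /=; rewrite ler_norml.
have := (sqr_ge0 (x + y'), sqr_ge0 (x - y'), sqr_ge0 (y + x'), sqr_ge0 (y - x')).
by move=> [[[? ?] ?] ?]; apply/andP; split; nra.
Qed.

(** The gap between the two sides is |z - t w|^2 / (2 t). The free parameter t lets this bound
    replace the Cauchy-Schwarz inequality below. *)
Lemma Re_mulJ_young t z w : 0 < t ->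
  complex.Re (z * conjc w) <= 2^-1 * (t^-1 * nsq z) + 2^-1 * (t * nsq w).
Proof.
move=> t0; rewrite !nsqE; case: z w => x y [x' y'] /=.
have -> : 2^-1 * (t^-1 * (x ^+ 2 + y ^+ 2)) + 2^-1 * (t * (x' ^+ 2 + y' ^+ 2)) =
   x * x' - y * - y' + 2^-1 * t^-1 * ((x - t * x') ^+ 2 + (y - t * y') ^+ 2).
  by field; rewrite gt_eqF.
by rewrite lerDl mulr_ge0// ?addr_ge0 ?sqr_ge0// mulr_ge0// ?invr_ge0// ltW.
Qed.

Lemma rsum1 u a : (forall v, v != u -> a v = 0) -> rsum a = a u.
Proof.
move=> a0; rewrite /rsum.
have E (b : V -> R) : (forall v, 0 <= b v) -> (forall v, v != u -> b v = 0) ->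
    fine (total b) = b u.
  move=> b0 bu; rewrite (_ : total b = (\esum_(v in [set u]) (b v)%:E)%E).
    by rewrite esum_set1// lee_fin.
  rewrite [RHS]esum_mkcond; apply: eq_esum => v _; case: ifPn => //.
  by rewrite notin_setE => /eqP /bu ->.
rewrite -/(total (fun v => Num.max (a v) 0)) -/(total (fun v => Num.max (- a v) 0)).
rewrite !E ?max0_sub//; try by move=> v; exact: max0_ge0.
  by move=> v /a0 ->; rewrite oppr0 maxxx.
by move=> v /a0 ->; rewrite maxxx.
Qed.

(** [inner] is convertible to [csum] of the pointwise products, so linearity and regrouping can be
    stated for a single family. *)
Definition csum h : C :=
  Complex (rsum (fun v => complex.Re (h v))) (rsum (fun v => complex.Im (h v))).

Definition csummable h :=
  abs_summable (fun v => complex.Re (h v)) /\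
  abs_summable (fun v => complex.Im (h v)).

Lemma eq_csum h h' : h =1 h' -> csum h = csum h'.
Proof. by move=> /funext ->. Qed.

Lemma csumZ z h : csummable h -> csum (fun v => z * h v) = z * csum h.
Proof.
move=> [hR hI]; case: z => x y; apply/eqP; rewrite eq_complex /csum /=.
apply/andP; split; apply/eqP; rewrite -!rsumZ//.
  rewrite -rsumN -rsumD; first by apply: eq_rsum => v /=; case: (h v).
    exact: abs_summableZ.
  rewrite (_ : (fun v => _) = (fun v => - y * complex.Im (h v))).
    exact: abs_summableZ.
  by apply: funext => v; rewrite mulNr.
rewrite -rsumD; try exact: abs_summableZ.
by apply: eq_rsum => v /=; case: (h v).
Qed.

Lemma csum_fibers p h : csummable h ->
  csum h = csum (fun u => csum (fun v => if p v == u then h v else 0)).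
Proof.
move=> [hR hI]; rewrite /csum /= (rsum_fibers p hR) (rsum_fibers p hI).
by congr Complex; apply: eq_rsum => u; apply: eq_rsum => v; case: ifP.
Qed.

Lemma innerE f g : inner f g = csum (fun v => f v * conjc (g v)).
Proof. by []. Qed.

Lemma sqnormE f : sqnorm f = total (fun v => nsq (f v)).
Proof. by []. Qed.

Lemma sqnorm_ge0 f : (0 <= sqnorm f)%E.
Proof. by rewrite sqnormE; apply: total_ge0. Qed.

Lemma sqnorm_fineK f : l2 f -> (fine (sqnorm f))%:E = sqnorm f.
Proof. by rewrite /l2 sqnormE; apply: total_fineK. Qed.

Lemma csummable_l2 f g : l2 f -> l2 g -> csummable (fun v => f v * conjc (g v)).
Proof.
move=> f2 g2; have fg : (total (fun v => nsq (f v) + nsq (g v))%R < +oo)%E.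
  by rewrite totalD//; apply: lte_add_pinfty.
split.
  by apply: abs_summable_le fg => v; exact: le_absRe_nsq.
by apply: abs_summable_le fg => v; exact: le_absIm_nsq.
Qed.

Lemma inner_conj f g : inner g f = conjc (inner f g).
Proof.
rewrite /inner /= -rsumN; congr Complex; apply: eq_rsum => v;
  by case: (f v) (g v) => x y [x' y'] /=; ring.
Qed.

Lemma inner_self f : inner f f = (fine (sqnorm f))%:C.
Proof.
rewrite sqnormE -rsum_ge0E//; apply/eqP; rewrite eq_complex /=.
apply/andP; split; apply/eqP.
  by apply: eq_rsum => v; rewrite mulJ_nsq.
rewrite (@eq_rsum _ _ _ (fun=> 0)) => [|v]; last by rewrite mulJ_nsq.
by rewrite rsum_ge0E// /total esum1.
Qed.

Lemma l2_finsupp (F : set V) f : finite_set F -> (forall v, ~ F v -> f v = 0) ->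
  l2 f.
Proof.
move=> finF f0; rewrite /l2 (_ : sqnorm f = \esum_(v in F) (nsq (f v))%:E).
  rewrite esum_fset//; last by move=> v _; rewrite lee_fin.
  by rewrite fsumEFin// ltry.
rewrite [RHS]esum_mkcond; apply: eq_esum => v _; case: ifPn => //.
by rewrite notin_setE => /f0 ->; rewrite -/(nsq 0) nsq0.
Qed.

Definition delta (u : V) : V -> C := fun v => (v == u)%:R.

Lemma l2_delta u : l2 (delta u).
Proof.
apply: (@l2_finsupp [set u]) => // v /= /eqP/negbTE vu.
by rewrite /delta vu.
Qed.

Lemma inner_delta u g : inner (delta u) g = conjc (g u).
Proof.
have E v : delta u v * conjc (g v) = if v == u then conjc (g v) else 0.
  by rewrite /delta; case: eqP => _; rewrite ?mul1r ?mul0r.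
rewrite /inner (@rsum1 u) => [|v vu]; last by rewrite E (negbTE vu).
rewrite (@rsum1 u) => [|v vu]; last by rewrite E (negbTE vu).
by rewrite E eqxx; case: (g u).
Qed.

Lemma sqnorm_ge1 f u : ((nsq (f u))%:E <= sqnorm f)%E.
Proof.
rewrite sqnormE /total (esumID [set u])//; last by move=> v _; rewrite lee_fin.
rewrite setTI esum_set1 ?lee_fin// leeDl//.
by apply: esum_ge0 => v _; rewrite lee_fin.
Qed.

Definition maps_l2 (T : (V -> C) -> (V -> C)) : Prop := forall f, l2 f -> l2 (T f).

Lemma bounded_maps_l2 T : bounded_op T -> maps_l2 T.
Proof. by move=> [c Tc] f /Tc[]. Qed.

Lemma iter_maps_l2 T n : maps_l2 T -> maps_l2 (iter n T).
Proof. by move=> T2; elim: n => // n IH f f2 /=; apply/T2/IH. Qed.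

(** The outermost [T] is moved across first and becomes the innermost [A]; hence [iterS] on one side
    and [iterSr] on the other. *)
Lemma iter_adjoint T A n : maps_l2 T -> is_adjoint T A ->
  is_adjoint (iter n T) (iter n A).
Proof.
move=> T2 [A2 TA]; split; first exact: (@iter_maps_l2 A n).
elim: n => // n IH f g f2 g2.
rewrite [iter n.+1 T f]iterS TA//; last exact: iter_maps_l2.
by rewrite [iter n.+1 A g]iterSr IH//; exact: A2.
Qed.

(** By adjointness <A T f, f> = |T f|^2 and <T A f, f> = |A f|^2, so positivity of the commutator
    compares two norms. *)
Lemma hyponormalP T : maps_l2 T ->
  hyponormal T <->
  exists2 A, is_adjoint T A & forall f, l2 f -> (sqnorm (A f) <= sqnorm (T f))%E.
Proof.
move=> T2.
have E A f : is_adjoint T A -> l2 f ->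
    (0 <= inner (A (T f)) f - inner (T (A f)) f) =
    (sqnorm (A f) <= sqnorm (T f))%E.
  move=> [A2 TA] f2; rewrite inner_conj -TA//; last exact: T2.
  rewrite [inner (T (A f)) f]TA//; last exact: A2.
  rewrite !inner_self conjc_real -rmorphB ler0c subr_ge0.
  by rewrite -lee_fin !sqnorm_fineK//; [exact: T2|exact: A2].
split.
  by move=> [A [TA H]]; exists A => // f f2; rewrite -(E A f)//; exact: H.
by move=> [A TA H]; exists A; split => // f f2; rewrite E//; exact: H.
Qed.

End ComplexSums.
#[global] Hint Extern 0 (is_true (0 <= nsq _)) => solve [apply: nsq_ge0] : core.

(** * The criterion for hyponormality, over an arbitrary self-map [p] so that it also covers
    powers *)

Section ShiftCriterion.
Variables (R : realType) (V : choiceType) (p : V -> V) (lam : V -> R[i]).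
Local Notation C := R[i].
Local Notation T := (Gamma p lam).
Implicit Types (f g : V -> C) (F : set V) (s : V -> R).

(** This is d(u) = |T e_u|^2, extended-real valued because its finiteness comes only from [T]
    preserving [l2]. *)
Definition fiber_weight (u : V) : \bar R :=
  (\esum_(v in p @^-1` [set u]) (nsq (lam v))%:E)%E.
Local Notation d := fiber_weight.

Lemma fiber_weight_ge0 u : (0 <= d u)%E.
Proof. by apply: esum_ge0 => v _; rewrite lee_fin. Qed.
Hint Resolve fiber_weight_ge0 : core.

Lemma sqnorm_Gamma f :
  sqnorm (T f) = (\esum_(u in [set: V]) ((nsq (f u))%:E * d u))%E.
Proof.
rewrite sqnormE /total (esum_fibers p) => [|v]; last by rewrite lee_fin.
apply: eq_esum => u _; rewrite /fiber_weight -esumZl//; last first.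
  by move=> v; rewrite lee_fin.
by apply: eq_esum => v /= <-; rewrite /Gamma nsqM mulrC EFinM.
Qed.

Hypothesis T2 : maps_l2 T.

Lemma fiber_weight_lty u : (d u < +oo)%E.
Proof.
have := T2 (l2_delta R u); apply: le_lt_trans.
rewrite sqnorm_Gamma (esumID [set u])//; last first.
  by move=> w _; rewrite mule_ge0// lee_fin.
rewrite setTI esum_set1 /delta ?eqxx; last by rewrite mule_ge0// lee_fin.
have -> : nsq (1%:R : C) = 1 by rewrite -[1%:R]/((1 : R)%:C) nsq_real expr1n.
rewrite mul1e leeDl//; apply: esum_ge0 => w _.
by rewrite mule_ge0// lee_fin.
Qed.

Lemma fiber_weight_fineK u : (fine (d u))%:E = d u.
Proof. by rewrite fineK// ge0_fin_numE// fiber_weight_lty. Qed.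

Lemma sqnorm_Gamma_total f :
  sqnorm (T f) = total (fun u => fine (d u) * nsq (f u)).
Proof.
rewrite sqnorm_Gamma; apply: eq_esum => u _.
by rewrite [RHS]EFinM fiber_weight_fineK muleC.
Qed.

Let fine_d_ge0 u : 0 <= fine (d u). Proof. exact: fine_ge0. Qed.

Lemma total_finsupp F (a : V -> R) : finite_set F -> (forall v, 0 <= a v) ->
  (forall v, ~ F v -> a v = 0) -> total a = (\sum_(v \in F) a v)%:E.
Proof.
move=> finF a0 aF; rewrite (_ : total a = \esum_(v in F) (a v)%:E).
  rewrite esum_fset// ?fsumEFin// => v _; by rewrite lee_fin.
rewrite [RHS]esum_mkcond; apply: eq_esum => v _; case: ifPn => //.
by rewrite notin_setE => /aF ->.
Qed.

(* Test the inequality |A f|^2 <= |T f|^2 on f = lam * s. *)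
Lemma adjoint_test A u F s : is_adjoint T A ->
  (forall f, l2 f -> (sqnorm (A f) <= sqnorm (T f))%E) ->
  finite_set F -> F `<=` p @^-1` [set u] ->
  (forall v, 0 <= s v) -> (forall v, ~ F v -> s v = 0) ->
  (\sum_(v \in F) s v * nsq (lam v)) ^+ 2 <=
   \sum_(v \in F) fine (d v) * s v ^+ 2 * nsq (lam v).
Proof.
move=> [A2 TA] hyp finF Fu s0 sF.
pose f v := lam v * (s v)%:C.
have f2 : l2 f.
  by apply: (l2_finsupp finF) => v /sF; rewrite /f => ->; rewrite mulr0.
have sq0 v : 0 <= s v * nsq (lam v) by rewrite mulr_ge0.
have Afu : conjc (A f u) = (\sum_(v \in F) s v * nsq (lam v))%:C.
  rewrite -inner_delta -TA//; last exact: l2_delta.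
  have E v : T (delta R u) v * conjc (f v) = (s v * nsq (lam v))%:C.
    rewrite /Gamma /delta /f; have [Fv|/sF ->] := pselect (F v); last first.
      by rewrite mulr0 mul0r conjc0 mulr0.
    rewrite (Fu _ Fv) eqxx mulr1 rmorphM mulrA mulJ_nsq.
    by rewrite [X in _ * X]conjc_real -rmorphM mulrC.
  apply/eqP; rewrite eq_complex /=; apply/andP; split; apply/eqP.
    rewrite (@eq_rsum _ _ _ (fun v => s v * nsq (lam v))) => [|v]; last by rewrite E.
    by rewrite rsum_ge0E// (@total_finsupp F)// => v /sF ->; rewrite mul0r.
  rewrite (@eq_rsum _ _ _ (fun=> 0)) => [|v]; last by rewrite E.
  by rewrite rsum_ge0E// /total esum1.
have := le_trans (sqnorm_ge1 (A f) u) (hyp f f2).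
rewrite -nsqJ Afu nsq_real sqnorm_Gamma_total (@total_finsupp F)//.
- rewrite lee_fin => /le_trans; apply; rewrite le_eqVlt; apply/orP; left.
  apply/eqP; apply: eq_fsbigr => v _.
  by rewrite /f nsqM nsq_real; ring.
- by move=> v; rewrite mulr_ge0.
- by move=> v /sF; rewrite /f => ->; rewrite mulr0 nsq0 mulr0.
Qed.

(** Testing on f = lam_v e_v gives |lam_v|^4 <= d(v) |lam_v|^2, and a nonzero factor cancels. *)
Lemma hyponormal_le_fiber_weight v :
  hyponormal T -> ((nsq (lam v))%:E <= d v)%E.
Proof.
move=> /(hyponormalP T2)[A TA hyp].
have [->|l0] := eqVneq (lam v) 0; first by rewrite nsq0.
have := @adjoint_test A (p v) [set v] (fun w => (w == v)%:R) TA hyp.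
rewrite !fsbig_set1 eqxx mul1r expr1n mulr1 => H.
rewrite -fiber_weight_fineK lee_fin -(@ler_pM2r _ (nsq (lam v))) ?nsq_gt0//.
rewrite -expr2 H//; first by move=> w ->.
by move=> w /= /eqP/negbTE ->.
Qed.

(** With s = 1 / d on a finite set of siblings the test inequality reads X^2 <= X for the partial
    sum X, whence X <= 1. *)
Lemma hyponormal_esum_le1 u : hyponormal T ->
  (\esum_(v in p @^-1` [set u]) (nsq (lam v) / fine (d v))%:E <= 1)%E.
Proof.
move=> /(hyponormalP T2)[A TA hyp].
apply: ge_ereal_sup => _ [F [finF Fu] <-].
have r0 v : 0 <= nsq (lam v) / fine (d v) by rewrite divr_ge0.
pose s v := if v \in F then (fine (d v))^-1 else 0.
have s0 v : 0 <= s v by rewrite /s; case: ifP => // _; rewrite invr_ge0.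
have sF v : ~ F v -> s v = 0 
  by move=> nF; rewrite /s; case: ifPn => //; rewrite inE.
have := adjoint_test TA hyp finF Fu s0 sF.
set X := \sum_(v \in F) _; set Y := \sum_(v \in F) _.
have XE : X = \sum_(v \in F) (nsq (lam v) / fine (d v)).
  by apply: eq_fsbigr => v; rewrite /s => ->; rewrite mulrC.
have -> : Y = X.
  apply: eq_fsbigr => v; rewrite /s => ->; congr (_ * _).
  (* Where d(v) = 0 the convention 0^-1 = 0 makes both terms vanish. *)
  have [->|d0] := eqVneq (fine (d v)) 0; first by rewrite invr0 mul0r.
  by rewrite expr2 mulrA divff// mul1r.
rewrite fsumEFin// -XE lee_fin => XX.
have X0 : 0 <= X by rewrite XE; apply: fsumr_ge0.
by rewrite leNgt; apply/negP => X1; nra.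
Qed.

(** For g = A f, |g|^2 = Re <T g, f>. Young's inequality with t = d(v) at each v bounds this by half
    the sum of r(v) |g(p v)|^2 plus half of |T f|^2, where r = |lam|^2 / d; grouped by parent, the
    first sum is at most |g|^2. The adjoint is a parameter because for a power it is an iterate. *)
Lemma adjoint_hyponormal A : is_adjoint T A ->
  (forall v, (nsq (lam v))%:E <= d v)%E ->
  (forall u, \esum_(v in p @^-1` [set u]) (nsq (lam v) / fine (d v))%:E <= 1)%E ->
  hyponormal T.
Proof.
move=> TA ld sum1; apply/(hyponormalP T2); exists A => // f f2.
case: (TA) => A2 adj; pose g := A f.
have g2 : l2 g by exact: A2.
have E : fine (sqnorm g) = complex.Re (inner (T g) f) by rewrite adj// inner_self.
pose r v := nsq (lam v) / fine (d v).
have r0 v : 0 <= r v by rewrite divr_ge0.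
pose b1 v := r v * nsq (g (p v)); pose b2 v := fine (d v) * nsq (f v).
have b10 v : 0 <= b1 v by rewrite mulr_ge0.
have b20 v : 0 <= b2 v by rewrite mulr_ge0.
have S1 : (total b1 <= sqnorm g)%E.
  rewrite /total (esum_fibers p) => [|v]; last by rewrite lee_fin.
  apply: le_esum => u _; rewrite -/(nsq (g u)).
  rewrite (@eq_esum _ _ _ _ (fun v => (nsq (g u))%:E * (r v)%:E)%E); last first.
    by move=> v /= <-; rewrite -EFinM mulrC.
  rewrite esumZl//.
  by rewrite -[leRHS]mule1 lee_wpmul2l// lee_fin.
have S2 : total b2 = sqnorm (T f) by rewrite sqnorm_Gamma_total.
have F1 : (total b1 < +oo)%E by apply: le_lt_trans S1 _.
have F2 : (total b2 < +oo)%E by rewrite S2; exact: T2.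
have half (b : V -> R) : (forall v, 0 <= b v) -> (total b < +oo)%E ->
    total (fun v => 2^-1 * b v) = (2^-1 * fine (total b))%:E.
  by move=> b0 boo; rewrite totalZ// EFinM total_fineK.
have : fine (sqnorm g) <= fine (total (fun v => 2^-1 * b1 v + 2^-1 * b2 v)).
  rewrite E /inner /=; apply: rsum_le => [v|v|].
  - by rewrite addr_ge0// mulr_ge0.
  - rewrite /Gamma /b1 /b2 /r; set D := fine (d v).
    (* If d(v) = 0 then lam_v = 0 by the first condition; otherwise d(v) is a legitimate Young
       parameter. *)
    have [D0|D0] := eqVneq D 0.
      have /eqP -> : lam v == 0.
        by rewrite -nsq_eq0 eq_le nsq_ge0 andbT -D0 -lee_fin fiber_weight_fineK.
      by rewrite nsq0 D0 !mul0r !mulr0 addr0.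
    have Dgt : 0 < D by rewrite lt0r D0 fine_d_ge0.
    apply: le_trans (Re_mulJ_young _ _ Dgt) _.
    by rewrite nsqM lerD2r [D^-1 * _]mulrC mulrAC.
  - by rewrite totalD ?half ?ltry// => v; rewrite mulr_ge0.
rewrite totalD; do ?by move=> v; rewrite mulr_ge0.
rewrite !half// fineD// S2 => H.
have : fine (total b1) <= fine (sqnorm g).
  apply: fine_le => //; first by rewrite ge0_fin_numE// total_ge0.
  by rewrite ge0_fin_numE ?sqnorm_ge0.
move=> H'; rewrite -[A f]/g -(sqnorm_fineK g2) -(sqnorm_fineK (T2 f2)) lee_fin.
have aux (x y z : R) : x <= 2^-1 * y + 2^-1 * z -> y <= x -> x <= z by lra.
exact: aux H H'.
Qed.

End ShiftCriterion.

(** * Boundedness of a shift and construction of its adjoint *)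

Section ShiftAdjoint.
Variables (R : realType) (V : choiceType) (p : V -> V) (lam : V -> R[i]).
Local Notation C := R[i].
Local Notation T := (Gamma p lam).
Implicit Types (f g : V -> C).
Variable c : R.
Hypothesis dc : forall u, (fiber_weight p lam u <= c%:E)%E.

Lemma sqnorm_Gamma_le f : (sqnorm (T f) <= c%:E * sqnorm f)%E.
Proof.
(* The sign of [c] is read off from the bound at some vertex, so an empty [V] is treated apart. *)
have [[u]|V0] := pselect (inhabited V); last first.
  by rewrite /sqnorm !esum1 ?mule0// => v; case: V0.
have c0 : 0 <= c by rewrite -lee_fin (le_trans (fiber_weight_ge0 p lam u)).
rewrite sqnorm_Gamma sqnormE /total -esumZl//; last first.
  by move=> v; rewrite lee_fin.
by apply: le_esum => v _; rewrite muleC lee_wpmul2r// lee_fin.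
Qed.

Lemma bounded_Gamma : bounded_op T.
Proof.
exists c => f f2; split; last exact: sqnorm_Gamma_le.
apply: le_lt_trans (sqnorm_Gamma_le f) _.
by rewrite -(sqnorm_fineK f2) -EFinM ltry.
Qed.

Let T2 : maps_l2 T. Proof. exact: bounded_maps_l2 bounded_Gamma. Qed.

(** The value at u is forced by <e_u, A g> = <T e_u, g>, since pairing e_u with a function gives its
    conjugate value at u. *)
Definition Gamma_adj g : V -> C := fun u => conjc (inner (T (delta R u)) g).
Local Notation A := Gamma_adj.

(** Grouping <T f, g> by parent, the factor f(u) is constant on the fibre over u and comes out of
    the inner sum. *)
Lemma inner_Gamma_adj f g : l2 f -> l2 g -> inner (T f) g = inner f (A g).
Proof.
move=> f2 g2; rewrite !innerE (csum_fibers p) => [|]; last first.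
  exact: csummable_l2 (T2 f2) g2.
apply: eq_csum => u; rewrite /A conjcK innerE -csumZ; last first.
  exact: csummable_l2 (T2 (l2_delta R u)) g2.
apply: eq_csum => v; rewrite /Gamma /delta.
by case: eqP => [->|_]; rewrite ?mulr1 ?mulr0 ?mul0r ?mulr0// mulrA (mulrC (lam v)).
Qed.

(** For each finite truncation f of A g, |f|^2 = <f, A g> = <T f, g>, and Young's inequality bounds
    this by half of |f|^2 plus half of k |g|^2. So |f|^2 <= k |g|^2 uniformly in the truncation. *)
Lemma l2_Gamma_adj g : l2 g -> l2 (A g).
Proof.
(* Adding 1 makes [k] positive, as needed for division, while still k >= c. *)
move=> g2; pose k := `|c| + 1.
have k0 : 0 < k by rewrite ltr_wpDl.
suff : (sqnorm (A g) <= (k * fine (sqnorm g))%:E)%E by move/le_lt_trans; apply; exact: ltry.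
apply: ge_ereal_sup => _ [F [finF _] <-].
pose f u := if u \in F then A g u else 0.
have fF v : ~ F v -> f v = 0.
  by move=> nF; rewrite /f; case: ifPn => //; rewrite inE.
have f2 : l2 f by exact: l2_finsupp finF fF.
have fE : sqnorm f = (\sum_(u \in F) (nsq (A g u))%:E)%E.
  rewrite sqnormE (@total_finsupp _ _ F)// => [|v /fF ->]; last exact: nsq0.
  rewrite fsumEFin//; congr EFin; apply: eq_fsbigr => v vF.
  by rewrite /f vF.
rewrite -fE -sqnorm_fineK// lee_fin.
have inner_f : inner f (A g) = inner f f.
  rewrite !innerE; apply: eq_csum => v; rewrite /f.
  by case: ifP => // _; rewrite !mul0r.
pose b1 v := k^-1 * nsq (T f v); pose b2 v := k * nsq (g v).
have b10 v : 0 <= 2^-1 * b1 v by rewrite mulr_ge0// mulr_ge0// invr_ge0 ltW.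
have b20 v : 0 <= 2^-1 * b2 v by rewrite mulr_ge0// mulr_ge0// ltW.
have tb1 : total (fun v => 2^-1 * b1 v) = (2^-1 * (k^-1 * fine (sqnorm (T f))))%:E.
  rewrite totalZ//; last by move=> v; rewrite mulr_ge0// invr_ge0 ltW.
  by rewrite totalZ// ?invr_ge0 ?(ltW k0)// -sqnormE -sqnorm_fineK//; exact: T2.
have tb2 : total (fun v => 2^-1 * b2 v) = (2^-1 * (k * fine (sqnorm g)))%:E.
  rewrite totalZ//; last by move=> v; rewrite mulr_ge0// ltW.
  by rewrite totalZ// ?(ltW k0)// -sqnormE -sqnorm_fineK.
have H : fine (sqnorm f) <= 2^-1 * (k^-1 * fine (sqnorm (T f)))
    + 2^-1 * (k * fine (sqnorm g)).
  rewrite (_ : fine (sqnorm f) = complex.Re (inner (T f) g)); last first.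
    by rewrite inner_Gamma_adj// inner_f inner_self.
  rewrite -[leRHS]/(fine (_ + _)%:E) EFinD -tb1 -tb2 -totalD//.
  apply: rsum_le => [v|v|]; first by rewrite addr_ge0.
    exact: Re_mulJ_young.
  by rewrite totalD// tb1 tb2 ltry.
have H' : k^-1 * fine (sqnorm (T f)) <= fine (sqnorm f).
  rewrite mulrC ler_pdivrMr// mulrC -lee_fin EFinM !sqnorm_fineK//; last exact: T2.
  apply: le_trans (sqnorm_Gamma_le f) _; apply: lee_wpmul2r; first exact: sqnorm_ge0.
  by rewrite lee_fin /k (le_trans (ler_norm c))// lerDl.
have aux (x y z : R) : x <= 2^-1 * y + 2^-1 * z -> y <= x -> x <= z by lra.
exact: aux H H'.
Qed.

Lemma is_adjoint_Gamma_adj : is_adjoint T A.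
Proof. by split; [exact: l2_Gamma_adj|exact: inner_Gamma_adj]. Qed.

End ShiftAdjoint.

(** * Thinner maps inherit the forest property *)

Section ForestLemmas.
Variable V : Type.
Implicit Types p q : V -> V.

(** On a nontrivial cycle of [q] no vertex is fixed, so [q] agrees with [p] along it. The cycle is
    then one of [p], hence trivial. *)
Lemma thinner_forest p q : directed_forest p -> thinner q p -> directed_forest q.
Proof.
move=> Hp qp n v qv; apply: contrapT => nv.
have moving k : (k <= n)%N -> q (iter k q v) <> iter k q v.
  move=> kn fixk.
  have stay m : iter (m + k) q v = iter k q v by elim: m => //= m ->.
  have E : v = iter k q v by rewrite -{1}qv -(subnK (leqW kn)) stay.
  by apply: nv; rewrite {1}E fixk -E.
have qpE k : (k <= n.+1)%N -> iter k q v = iter k p v.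
  elim: k => // k IH kn; rewrite /= -IH 1?ltnW//.
  by case: (qp (iter k q v)) => // /(moving k kn).
have := Hp n v; rewrite -qpE// => /(_ qv) pv.
by case: (qp v) => //; rewrite pv.
Qed.

End ForestLemmas.

(** * Powers of a hyponormal shift with unbranched support *)

Section IteratedShift.
Variables (R : realType) (V : choiceType) (p : V -> V) (lam : V -> R[i]).

Fixpoint iter_weight n (v : V) : R[i] :=
  if n is m.+1 then lam v * iter_weight m (p v) else 1.

(** The n-th power is again a shift, along the n-th iterate of [p], so the criterion applies to
    it. *)
Lemma iter_Gamma n : iter n (Gamma p lam) = Gamma (iter n p) (iter_weight n).
Proof.
apply/funext => f; apply/funext => v.
elim: n v => [|n IH] v; first by rewrite /Gamma /= mul1r.
by rewrite iterS {1}/Gamma IH /Gamma -iterSr /= mulrA.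
Qed.

Hypothesis T2 : maps_l2 (Gamma p lam).
Hypothesis hyp : hyponormal (Gamma p lam).
(** On the support of [lam], [c] selects the one child of nonzero weight; the hypotheses on it
    express that the support is leafless and forkless. *)
Variable c : V -> V.
Hypothesis pc : forall v, lam v != 0 -> p (c v) = v.
Hypothesis lamc : forall v, lam v != 0 -> lam (c v) != 0.
Hypothesis cp : forall v, lam (p v) != 0 -> lam v != 0 -> c (p v) = v.
Local Notation W := iter_weight.
Local Notation d := (fiber_weight p lam).

Lemma fiber_weight_child v : lam v != 0 -> d v = (nsq (lam (c v)))%:E.
Proof.
move=> v0; rewrite -[RHS](@esum_set1 _ _ (c v) (fun w => (nsq (lam w))%:E)) ?lee_fin//.
rewrite /fiber_weight esum_mkcond [RHS]esum_mkcond; apply: eq_esum => w _.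
case: ifPn; rewrite ?inE ?notin_setE /= => pw; case: ifPn; rewrite ?inE ?notin_setE /= => wc //.
  have [->|w0] := eqVneq (lam w) 0; first by rewrite nsq0.
  by case: wc; rewrite -pw cp ?pw.
by case: pw; rewrite wc pc.
Qed.

Lemma nsq_lam_child v : lam v != 0 -> nsq (lam v) <= nsq (lam (c v)).
Proof.
by move=> v0; rewrite -lee_fin -fiber_weight_child// hyponormal_le_fiber_weight.
Qed.

Lemma lam_iter_child k v : lam v != 0 -> lam (iter k c v) != 0.
Proof. by move=> v0; elim: k => //= k; exact: lamc. Qed.

Lemma nsq_lam_iter_child k v : lam v != 0 -> nsq (lam v) <= nsq (lam (iter k c v)).
Proof.
move=> v0; elim: k => //= k /le_trans; apply.
by rewrite nsq_lam_child// lam_iter_child.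
Qed.

Lemma iter_parent_child k v : lam v != 0 -> iter k p (iter k c v) = v.
Proof.
move=> v0; elim: k => // k IH.
by rewrite iterSr iterS pc ?IH// lam_iter_child.
Qed.

(** The factors of the product are the weights at v, p v, ..., p^n v; when none vanishes, [c]
    retraces the path. *)
Lemma iter_weight_neq0 n v : W n.+1 v != 0 ->
  [/\ lam v != 0, lam (iter n p v) != 0 & iter n c (iter n p v) = v].
Proof.
elim: n v => [|n IH] v /=; rewrite mulf_eq0 negb_or => /andP[v0] //.
move=> /IH[pv0]; rewrite -iterSr iterS => ? E; split => //.
by rewrite E cp.
Qed.

Lemma nsq_iter_weight_child n z : lam z != 0 -> nsq (W n z) <= nsq (W n (c z)).
Proof.
elim: n z => //= n IH z z0; rewrite pc// !nsqM ler_pM// ?nsq_lam_child//.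
(* If the parent has weight zero, the left side is 0, or both sides are the empty product 1 when n =
   0. *)
have [pz0|pz0] := eqVneq (lam (p z)) 0; last by have := IH _ pz0; rewrite cp.
by case: n {IH} => //= n; rewrite pz0 mul0r nsq0.
Qed.

Lemma nsq_iter_weight_iter_child n k z :
  lam z != 0 -> nsq (W n z) <= nsq (W n (iter k c z)).
Proof.
move=> z0; elim: k => //= k /le_trans; apply.
by rewrite nsq_iter_weight_child// lam_iter_child.
Qed.

(** Let x = p^n v and a_i = |lam|^2 at c^i x, so that v = c^n x. The claim is a_0 ... a_n a_1 <= a_0
    a_{n+1} ... a_{2n+1}, true because a_i is nondecreasing. The induction splits off the factor at
    v. *)
Lemma nsq_iter_weight_ratio n v : W n.+1 v != 0 ->
  nsq (W n.+1 v) * nsq (lam (c (iter n p v))) <=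
  nsq (lam (iter n p v)) * nsq (W n.+1 (iter n.+1 c v)).
Proof.
elim: n v => [|n IH] v; first by move=> v0 /=; rewrite !mulr1.
move=> Wv; have [v0 _ _] := iter_weight_neq0 Wv.
have Wpv : W n.+1 (p v) != 0 by move: Wv; rewrite mulf_eq0 negb_or => /andP[].
have [pv0 _ _] := iter_weight_neq0 Wpv.
rewrite [W n.+2 v]/(lam v * W n.+1 (p v)).
rewrite [W n.+2 _]/(lam (iter n.+2 c v) * W n.+1 (p (iter n.+2 c v))).
rewrite [p (iter n.+2 c v)](pc (lam_iter_child n.+1 v0)).
rewrite [iter n.+1 p v]iterSr (nsqM (lam v)) (nsqM (lam (iter _ c v))).
rewrite -mulrA [leRHS]mulrCA; apply: ler_pM => //; first by rewrite mulr_ge0.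
  exact: nsq_lam_iter_child.
(* Since v = c (p v), the bound at p v stops one vertex short; one more step along [c] does not
   decrease the weight. *)
apply: le_trans (IH _ Wpv) _; rewrite ler_wpM2l// -{2}(cp pv0 v0) -iterSr.
by rewrite [iter n.+2 _ _]iterS nsq_iter_weight_child// lam_iter_child.
Qed.

Lemma le_fiber_iter_weight n v : lam v != 0 ->
  ((nsq (W n.+1 (iter n.+1 c v)))%:E <= fiber_weight (iter n.+1 p) (W n.+1) v)%E.
Proof.
move=> v0; rewrite /fiber_weight (esumID [set iter n.+1 c v]); last first.
  by move=> w _; rewrite lee_fin.
rewrite setIidr; last by move=> w ->; exact: iter_parent_child.
rewrite esum_set1 ?lee_fin// leeDl//.
by apply: esum_ge0 => w _; rewrite lee_fin.
Qed.

(* The term of v is at most the term of x = p^n v in the criterion for the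
   first power at the same vertex u, and v |-> x is injective. *)
Lemma esum_iter_ratio n u :
  (\esum_(v in (iter n.+1 p) @^-1` [set u])
     (nsq (W n.+1 v) / fine (fiber_weight (iter n.+1 p) (W n.+1) v))%:E <= 1)%E.
Proof.
set e := iter n p.
pose r x := nsq (lam x) / fine (d x).
pose B := (iter n.+1 p) @^-1` [set u] `&` [set v | W n.+1 v != 0].
have T2n : maps_l2 (Gamma (iter n.+1 p) (W n.+1)).
  by rewrite -iter_Gamma; exact: iter_maps_l2.
have r0 x : 0 <= r x by rewrite divr_ge0// fine_ge0// fiber_weight_ge0.
apply: (@le_trans _ _ (\esum_(v in B) (r (e v))%:E)%E).
  rewrite /B esum_mkcondr; apply: le_esum => v _.
  have [Wv|] := eqVneq (W n.+1 v) 0.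
    by rewrite Wv nsq0 mul0r; case: ifP => // _; rewrite lee_fin.
  move=> Wv; rewrite mem_set// lee_fin.
  have [v0 x0 _] := iter_weight_neq0 Wv.
  have cx0 := lamc x0.
  rewrite /r /e fiber_weight_child//=.
  (* The denominator is bounded below by its single term at c^(n+1) v, after which the ratio
     inequality applies. *)
  have D := le_fiber_iter_weight n v0.
  rewrite -fiber_weight_fineK// lee_fin in D.
  have Wc : 0 < nsq (W n.+1 (iter n.+1 c v)).
    by rewrite (lt_le_trans _ (nsq_iter_weight_iter_child n.+1 n.+1 v0))// nsq_gt0.
  rewrite ler_pdivrMr ?(lt_le_trans Wc)// mulrAC ler_pdivlMr ?nsq_gt0//.
  apply: le_trans (nsq_iter_weight_ratio Wv) _.
  by rewrite ler_wpM2l.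
have einj : set_inj B e.
  move=> v w /set_mem[_ /= /iter_weight_neq0[_ _ vE]].
  move=> /set_mem[_ /= /iter_weight_neq0[_ _ wE]] E.
  by rewrite -vE -wE -/e E.
rewrite -(esum_image B e (fun x => (r x)%:E) einj).
apply: le_trans (hyponormal_esum_le1 T2 u hyp).
rewrite esum_mkcond [leRHS]esum_mkcond; apply: le_esum => x _.
case: ifPn => [|_]; last by case: ifP => // _; rewrite lee_fin; exact: r0.
by move=> /set_mem[v [vu _] <-]; rewrite mem_set.
Qed.

Lemma iter_hyponormal n : hyponormal (iter n.+1 (Gamma p lam)).
Proof.
have T2n := iter_maps_l2 n.+1 T2.
have [A [TA _]] := hyp.
have TAn := iter_adjoint n.+1 T2 TA.
rewrite iter_Gamma in T2n TAn *.
apply: (adjoint_hyponormal T2n TAn) => [v|]; last exact: esum_iter_ratio.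
have [->|Wv] := eqVneq (W n.+1 v) 0; first by rewrite nsq0 fiber_weight_ge0.
have [v0 _ _] := iter_weight_neq0 Wv.
apply: le_trans (le_fiber_iter_weight n v0).
by rewrite lee_fin nsq_iter_weight_iter_child.
Qed.

End IteratedShift.

(** * Forkless leafless subforests force power hyponormality *)

Lemma forkless_power_hyponormal (R : realType) (V : choiceType) (p : V -> V)
    (lam : V -> R[i]) :
  directed_forest p ->
  (forall q : V -> V, directed_forest q -> leafless q -> thinner q p -> forkless q) ->
  weight_system p lam -> bounded_op (Gamma p lam) -> hyponormal (Gamma p lam) ->
  power_hyponormal (Gamma p lam).
Proof.
move=> Hp fk ws /bounded_maps_l2 T2 hyp.
(* Every vertex of weight zero becomes a root, so only edges carrying weight survive. *)
pose q v := if lam v == 0 then v else p v.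
have qp : thinner q p by move=> v; rewrite /q; case: ifP; [left|right].
have moving v : lam v != 0 -> p v <> v by move=> + pv; rewrite ws ?eqxx.
have ql : leafless q.
  move=> v; have [v0|v0] := eqVneq (lam v) 0; first by exists v; rewrite /q v0 eqxx.
  have [[w [pw w0]]|nw] := pselect (exists w, p w = v /\ lam w != 0).
    by exists w; rewrite /q (negbTE w0).
  (* Without a child of nonzero weight d(v) would be 0, contradicting |lam_v|^2 <= d(v). *)
  have := hyponormal_le_fiber_weight T2 v hyp.
  rewrite /fiber_weight esum1 => [|w pw].
    by rewrite lee_fin leNgt nsq_gt0 v0.
  have [->|w0] := eqVneq (lam w) 0; first by rewrite nsq0.
  by case: nw; exists w.
have qf := fk q (thinner_forest Hp qp) ql qp.
(* The condition sits under the existential so that choice yields a total function, unconstrained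
   off the support. *)
have child v : exists u, lam v != 0 ->
    [/\ p u = v, lam u != 0 & forall w, p w = v -> lam w != 0 -> w = u].
  have [v0|v0] := eqVneq (lam v) 0; first by exists v.
  have [|u uE] := qf v; first by rewrite /is_root /q (negbTE v0); exact: moving.
  exists u => _.
  have chi w : Chi q v w <-> p w = v /\ lam w != 0.
    rewrite /Chi /= /q; split.
      by case: eqVneq => [_ [-> //]|w0 []].
    move=> [pw w0]; rewrite (negbTE w0); split => // vw.
    by apply: (moving w w0); rewrite pw.
  have /chi[pu u0] : Chi q v u by rewrite uE.
  split => // w pw w0; have : Chi q v w by apply/chi.
  by rewrite uE.
have [c cP] := choice child.
move=> [//|n] _; apply: (@iter_hyponormal _ _ _ _ T2 hyp c) => v.
- by move=> /cP[].
- by move=> /cP[].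
- by move=> /cP[_ _ +] v0 => /(_ v erefl v0).
Qed.

(** * A hyponormal shift at a fork whose square is not hyponormal *)

Lemma esum_fiber1 (R : realType) (V : choiceType) (p : V -> V) (x y : V) (h : V -> R) :
  (forall z, 0 <= h z) -> p y = x -> (forall z, p z = x -> z <> y -> h z = 0) ->
  (\esum_(z in p @^-1` [set x]) (h z)%:E = (h y)%:E)%E.
Proof.
move=> h0 yx hx; rewrite (esumID [set y]) => [|z _]; last by rewrite lee_fin.
rewrite setIidr; last by move=> z ->.
rewrite esum_set1 ?lee_fin// esum1 ?adde0// => z /= [zx zy].
by rewrite hx.
Qed.

Section Fork.
Variables (R : realType) (V : choiceType) (p q c : V -> V) (v u1 u2 : V).
Hypotheses (Fq : directed_forest q) (qp : thinner q p) (qc : forall x, q (c x) = x).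
Hypotheses (qv : q v <> v) (qu1 : Chi q v u1) (qu2 : Chi q v u2) (u12 : u1 <> u2).

(** The orbit of u under a section [c] of [q], which exists because [q] is leafless. *)
Let branch (u z : V) : Prop := exists k, z = iter k c u.

Lemma iter_qc k x : iter k q (iter k c x) = x.
Proof. by elim: k x => // k IH x; rewrite iterSr iterS qc IH. Qed.

(** If v = c^k u then q^(k+1) v = q u = v, a cycle through a vertex that is not a root. *)
Lemma root_notin_branch u : Chi q v u -> ~ branch u v.
Proof.
move=> [qu _] [k E]; apply: qv; apply: (Fq (n := k)).
by rewrite [X in iter _ _ X]E iterS iter_qc.
Qed.

Lemma parent_notin_branch u : Chi q v u -> ~ branch u (q v).
Proof.
move=> [qu _] [k E]; apply: qv; apply: (Fq (n := k.+1)).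
by rewrite iterSr E iterS iter_qc.
Qed.

Lemma branch_moving u z : Chi q v u -> branch u z -> q z <> z.
Proof.
move=> [qu vu] [k ->] fixz.
have E : iter k q (iter k c u) = iter k c u by elim: {1}k => //= j ->.
rewrite iter_qc in E; apply: vu.
by rewrite -{1}qu [in LHS]E fixz -E.
Qed.

Lemma branch_parent u z : Chi q v u -> branch u z -> z <> u ->
  branch u (q z) /\ z = c (q z).
Proof.
move=> _ [[|k] ->] // _; rewrite iterS qc; split => //.
by exists k.
Qed.

Lemma branch_child u k z : Chi q v u -> z = iter k.+1 c u -> z <> u.
Proof.
move=> Cu -> E; apply: (root_notin_branch Cu); exists k.
by case: Cu => <- _; rewrite -{1}E iterS qc.
Qed.

(** Applying [q] to a common vertex as often as the shorter path allows puts one of [u1], [u2] on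
    the branch of the other. They differ, so one more [q] puts v on that branch. *)
Lemma branch_disjoint z : branch u1 z -> branch u2 z -> False.
Proof.
have key u u' j : Chi q v u -> Chi q v u' -> u <> u' -> u = iter j c u' -> False.
  move=> [qu _] Cu'; case: j => // j uu' E; apply: (root_notin_branch Cu').
  by exists j; rewrite -qu E iterS qc.
move=> [k ->] [j E]; have [kj|/ltnW jk] := leqP k j.
  apply: (key u1 u2 (j - k)%N) => //.
  by rewrite -[LHS](iter_qc k) E -{1}(subnKC kj) iterD iter_qc.
apply: (key u2 u1 (k - j)%N) => //; first exact/nesym.
by rewrite -[LHS](iter_qc j) -E -{1}(subnKC jk) iterD iter_qc.
Qed.

(* In the first branch 1 is followed by 2: the square has weight 5 at u1 but
   norm 2 * 2 on its basis vector. The second branch only serves to make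
   |S e_v|^2 = 1 + 25 large enough to allow the weight 5 at v, at a cost of
   25/36 <= 1 - 1/4 in the criterion at v. *)
Definition fork_weight (z : V) : R :=
  if z == v then 5 else
  if `[< branch u1 z >] then (if z == u1 then 1 else 2) else
  if `[< branch u2 z >] then (if z == u2 then 5 else 6) else 0.
Local Notation m := fork_weight.

Let u1v : u1 != v. Proof. by apply/eqP => E; case: qu1 => _; rewrite E. Qed.

Lemma branch_neq_root u z : Chi q v u -> branch u z -> (z == v) = false.
Proof. by move=> Cu bz; apply/eqP => E; apply: (root_notin_branch Cu); rewrite -E. Qed.

Lemma fork_weight_v : m v = 5. Proof. by rewrite /m eqxx. Qed.

Lemma fork_weight_branch1 z : branch u1 z -> m z = if z == u1 then 1 else 2.
Proof. by move=> bz; rewrite /m (branch_neq_root qu1 bz) asboolT. Qed.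

Lemma fork_weight_branch2 z : branch u2 z -> m z = if z == u2 then 5 else 6.
Proof.
move=> bz; rewrite /m (branch_neq_root qu2 bz) asboolF ?asboolT// => bz1.
exact: branch_disjoint bz1 bz.
Qed.

Lemma fork_weight_neq0 z : m z <> 0 -> [\/ z = v, branch u1 z | branch u2 z].
Proof.
rewrite /m; case: eqP => [->|_]; first by constructor 1.
case: asboolP => [|_]; first by constructor 2.
by case: asboolP => [|_] //; constructor 3.
Qed.

Lemma fork_moving z : m z <> 0 -> q z <> z.
Proof. by move=> /fork_weight_neq0[->|/(branch_moving qu1)|/(branch_moving qu2)]. Qed.

Lemma fork_parent z : m z <> 0 -> p z = q z.
Proof. by move=> /fork_moving qz; case: (qp z). Qed.

(** Sorting the support by parent shows which vertices of each fibre of [p] can contribute to a sum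
    over it. *)
Lemma fork_parentE z : m z <> 0 ->
  [\/ z = v /\ p z = q v, z = u1 /\ p z = v, z = u2 /\ p z = v |
      (branch u1 (p z) \/ branch u2 (p z)) /\ z = c (p z)].
Proof.
move=> mz; rewrite (fork_parent mz); case: (fork_weight_neq0 mz) => [->|b|b].
- by constructor 1.
- have [->|/eqP zu] := eqVneq z u1; first by constructor 2; case: qu1.
  by constructor 4; have [] := branch_parent qu1 b zu; split=> //; left.
- have [->|/eqP zu] := eqVneq z u2; first by constructor 3; case: qu2.
  by constructor 4; have [] := branch_parent qu2 b zu; split=> //; right.
Qed.

Lemma branch_succ u x : branch u x -> branch u (c x).
Proof. by move=> [k ->]; exists k.+1. Qed.

Lemma fork_weight_succ1 x : branch u1 x -> m (c x) = 2.
Proof.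
move=> bx; rewrite fork_weight_branch1; last exact: branch_succ.
by case: bx => k ->; case: eqP => // /(branch_child (k := k) qu1 erefl).
Qed.

Lemma fork_weight_succ2 x : branch u2 x -> m (c x) = 6.
Proof.
move=> bx; rewrite fork_weight_branch2; last exact: branch_succ.
by case: bx => k ->; case: eqP => // /(branch_child (k := k) qu2 erefl).
Qed.

Lemma fork_weight_u1 : m u1 = 1.
Proof. by rewrite fork_weight_branch1 ?eqxx//; exists 0%N. Qed.

Lemma fork_weight_u2 : m u2 = 5.
Proof. by rewrite fork_weight_branch2 ?eqxx//; exists 0%N. Qed.

Lemma fork_p_succ x : branch u1 x \/ branch u2 x -> p (c x) = x.
Proof.
move=> bx; rewrite fork_parent ?qc//.
case: bx => bx; first by rewrite fork_weight_succ1//; apply/eqP; rewrite pnatr_eq0.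
by rewrite fork_weight_succ2//; apply/eqP; rewrite pnatr_eq0.
Qed.

Section FiberSums.
(** [h] stands for the squared weight and for its quotient by d, so the fibre sums serve both
    conditions of the criterion. *)
Variable h : V -> R.
Hypotheses (h0 : forall z, 0 <= h z) (hm : forall z, m z = 0 -> h z = 0).
Local Notation fsum x := (\esum_(z in p @^-1` [set x]) (h z)%:E)%E.

Let hE z : (m z <> 0 -> h z = 0) -> h z = 0.
Proof. by move=> H; have [/hm|/eqP/H] := eqVneq (m z) 0. Qed.

Lemma fork_sum_parent : fsum (q v) = (h v)%:E.
Proof.
apply: esum_fiber1 => // [|z zw zv].
  by apply: fork_parent; rewrite fork_weight_v; apply/eqP; rewrite pnatr_eq0.
apply: hE => /fork_parentE; rewrite zw => -[[]//|[_ /qv]//|[_ /qv]//|].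
by move=> [[/(parent_notin_branch qu1)|/(parent_notin_branch qu2)]].
Qed.

Lemma fork_sum_fork : fsum v = (h u1 + h u2)%:E.
Proof.
have pu1 : p u1 = v.
  rewrite fork_parent; first by case: qu1.
  by rewrite fork_weight_u1; apply/eqP; rewrite oner_eq0.
have pu2 : p u2 = v.
  rewrite fork_parent; first by case: qu2.
  by rewrite fork_weight_u2; apply/eqP; rewrite pnatr_eq0.
have hz z : p z = v -> z <> u1 -> z <> u2 -> h z = 0.
  move=> zv z1 z2; apply: hE => /fork_parentE; rewrite zv.
  move=> [[_ /esym/qv]//|[]//|[]//|].
  by move=> [[/(root_notin_branch qu1)|/(root_notin_branch qu2)]].
rewrite (esumID [set u1]) => [|z _]; last by rewrite lee_fin.
rewrite setIidr; last by move=> z ->.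
rewrite esum_set1 ?lee_fin// EFinD; congr (_ + _)%E.
rewrite (esumID [set u2]) => [|z _]; last by rewrite lee_fin.
rewrite setIidr; last by move=> z ->; split => //; exact: nesym.
rewrite esum_set1 ?lee_fin// esum1 ?adde0// => z /= [[zv z1] z2].
by rewrite hz.
Qed.

Lemma fork_sum_branch x : branch u1 x \/ branch u2 x -> fsum x = (h (c x))%:E.
Proof.
move=> bx; apply: esum_fiber1 => // [|z zx zc]; first exact: fork_p_succ.
apply: hE => /fork_parentE; rewrite zx => -[[_ E]|[_ E]|[_ E]|[_ //]].
- by move: bx; rewrite E => -[/(parent_notin_branch qu1)|/(parent_notin_branch qu2)].
- by move: bx; rewrite E => -[/(root_notin_branch qu1)|/(root_notin_branch qu2)].
- by move: bx; rewrite E => -[/(root_notin_branch qu1)|/(root_notin_branch qu2)].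
Qed.

Lemma fork_sum_other x :
  x <> q v -> x <> v -> ~ (branch u1 x \/ branch u2 x) -> fsum x = 0%E.
Proof.
move=> xw xv bx; rewrite esum1// => z /= zx; rewrite hE//.
by move=> /fork_parentE; rewrite zx => -[[]|[]|[]|[]].
Qed.

End FiberSums.

Variant fork_vertex (x : V) : Prop :=
| ForkParent of x = q v
| ForkRoot of x = v
| ForkBranch1 of branch u1 x
| ForkBranch2 of branch u2 x
| ForkOther of x <> q v & x <> v & ~ (branch u1 x \/ branch u2 x).

Lemma fork_vertexP x : fork_vertex x.
Proof.
have [xw|xw] := pselect (x = q v); first exact: ForkParent.
have [xv|xv] := pselect (x = v); first exact: ForkRoot.
have [x1|x1] := pselect (branch u1 x); first exact: ForkBranch1.
have [x2|x2] := pselect (branch u2 x); first exact: ForkBranch2.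
by apply: ForkOther => // -[].
Qed.

Definition fork_lam (z : V) : R[i] := (m z)%:C.
Local Notation lam := fork_lam.
Local Notation d := (fiber_weight p lam).

Let nsq_lam z : nsq (lam z) = m z ^+ 2. Proof. exact: nsq_real. Qed.
Let nsq_lam0 z : m z = 0 -> nsq (lam z) = 0.
Proof. by rewrite nsq_lam => ->; rewrite expr0n. Qed.

Lemma fork_d_parent : d (q v) = 25%:E.
Proof.
rewrite /fiber_weight fork_sum_parent// nsq_lam fork_weight_v.
by congr EFin; ring.
Qed.

Lemma fork_d_fork : d v = 26%:E.
Proof.
rewrite /fiber_weight fork_sum_fork// !nsq_lam fork_weight_u1 fork_weight_u2.
by congr EFin; ring.
Qed.

Lemma fork_d_branch1 x : branch u1 x -> d x = 4%:E.
Proof.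
move=> bx; rewrite /fiber_weight fork_sum_branch//; last by left.
by rewrite nsq_lam fork_weight_succ1//; congr EFin; ring.
Qed.

Lemma fork_d_branch2 x : branch u2 x -> d x = 36%:E.
Proof.
move=> bx; rewrite /fiber_weight fork_sum_branch//; last by right.
by rewrite nsq_lam fork_weight_succ2//; congr EFin; ring.
Qed.

Lemma fork_d_le x : (d x <= 36%:E)%E.
Proof.
case: (fork_vertexP x) => [->|->|b|b|xw xv xb].
- by rewrite fork_d_parent lee_fin ler_nat.
- by rewrite fork_d_fork lee_fin ler_nat.
- by rewrite fork_d_branch1// lee_fin ler_nat.
- by rewrite fork_d_branch2// lee_fin ler_nat.
- by rewrite /fiber_weight fork_sum_other// lee_fin ler0n.
Qed.

Lemma fork_weight_system : weight_system p lam.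
Proof.
move=> z pz; rewrite /lam; have [->//|/eqP mz] := eqVneq (m z) 0.
by case: (fork_moving mz); rewrite -(fork_parent mz).
Qed.

Lemma fork_bounded : bounded_op (Gamma p lam).
Proof. exact: bounded_Gamma fork_d_le. Qed.

(** The first condition reads 25 <= 26 at v, and 1 or 4 <= 4 and 25 or 36 <= 36 on the branches. The
    sums of the second are 25/26 at q v, 1/4 + 25/36 = 34/36 at v, 1 on the branches and 0
    elsewhere. *)
Lemma fork_hyponormal : hyponormal (Gamma p lam).
Proof.
have T2 := bounded_maps_l2 fork_bounded.
apply: (adjoint_hyponormal T2 (is_adjoint_Gamma_adj fork_d_le)) => [z|x].
  have [mz|/eqP mz] := eqVneq (m z) 0; first by rewrite nsq_lam0// fiber_weight_ge0.
  rewrite nsq_lam; case: (fork_weight_neq0 mz) => [->|b|b].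
  - by rewrite fork_d_fork fork_weight_v lee_fin; lra.
  - rewrite fork_d_branch1// fork_weight_branch1//.
    by case: ifP => _; rewrite lee_fin; lra.
  - rewrite fork_d_branch2// fork_weight_branch2//.
    by case: ifP => _; rewrite lee_fin; lra.
have r0 z : 0 <= nsq (lam z) / fine (d z).
  by rewrite divr_ge0// fine_ge0// fiber_weight_ge0.
have rm z : m z = 0 -> nsq (lam z) / fine (d z) = 0.
  by move=> mz; rewrite nsq_lam0// mul0r.
have b1u : branch u1 u1 by exists 0%N.
have b2u : branch u2 u2 by exists 0%N.
case: (fork_vertexP x) => [->|->|b|b|xw xv xb].
- rewrite fork_sum_parent// nsq_lam fork_weight_v fork_d_fork lee_fin /=; lra.
- rewrite fork_sum_fork// !nsq_lam fork_weight_u1 fork_weight_u2.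
  by rewrite fork_d_branch1// fork_d_branch2// lee_fin /=; lra.
- rewrite fork_sum_branch//; last by left.
  rewrite nsq_lam fork_weight_succ1// fork_d_branch1 ?lee_fin /=; last exact: branch_succ.
  lra.
- rewrite fork_sum_branch//; last by right.
  rewrite nsq_lam fork_weight_succ2// fork_d_branch2 ?lee_fin /=; last exact: branch_succ.
  lra.
- by rewrite fork_sum_other// lee_fin ler01.
Qed.

(** The necessary condition fails at [u1]: the squared weight there is 25, while the fibre weight is
    16, all from c (c u1). *)
Lemma fork_square_not_hyponormal : ~ hyponormal (iter 2 (Gamma p lam)).
Proof.
have T2 := iter_maps_l2 2 (bounded_maps_l2 fork_bounded).
rewrite iter_Gamma in T2 *.
move=> /(hyponormal_le_fiber_weight T2 u1).
have b1u : branch u1 u1 by exists 0%N.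
have nsqW z : nsq (iter_weight p lam 2 z) = m z ^+ 2 * m (p z) ^+ 2.
  by rewrite /= mulr1 nsqM !nsq_lam.
have m1 : m u1 <> 0 by rewrite fork_weight_u1; apply/eqP; rewrite oner_eq0.
have pu1 : p u1 = v by rewrite fork_parent//; case: qu1.
rewrite /fiber_weight (esum_fiber1 (y := c (c u1))) => //.
- have b1c := branch_succ b1u.
  rewrite !nsqW fork_p_succ; last by left.
  rewrite pu1 fork_weight_v fork_weight_u1 !fork_weight_succ1//.
  by rewrite lee_fin; lra.
- rewrite /= !fork_p_succ//; first by left.
  by left; exact: branch_succ.
(* Any other z with p (p z) = u1 contributes 0: nonzero weights at z and p z would force p z = c u1
   and z = c (c u1). *)
move=> z /= zu zc; rewrite nsqW.
have [->|/eqP mz] := eqVneq (m z) 0; first by rewrite expr0n mul0r.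
have [->|/eqP mpz] := eqVneq (m (p z)) 0; first by rewrite expr0n mulr0.
have pz : p z = c u1.
  have := fork_parentE mpz; rewrite zu => -[[_ E]|[_ E]|[_ E]|[_ //]].
  - by case: (parent_notin_branch qu1); rewrite -E.
  - by move: u1v; rewrite {1}E eqxx.
  - by move: u1v; rewrite {1}E eqxx.
case: (fork_parentE mz) => [[zv pzw]|[zu1 E]|[_ E]|[_ E]].
- by case: (parent_notin_branch qu1); rewrite -pzw pz; exact: branch_succ.
- by case: (root_notin_branch qu1); rewrite -E pz; exact: branch_succ.
- by case: (root_notin_branch qu1); rewrite -E pz; exact: branch_succ.
- by case: zc; rewrite E pz.
Qed.

End Fork.

(** * Existence of the leafless support and inheritance of forklessness *)

Section LeaflessSupport.
Variables (V : Type) (p : V -> V).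
Hypothesis Hp : directed_forest p.

Let moves (v : V) := exists r,
  [/\ directed_forest r, leafless r, thinner r p & r v <> v].

(** The support is the union of all leafless thinner forests: it keeps an edge when one of them
    does. Each agrees with [p] where it moves a vertex, so its edges are edges of the union and
    supply the children. *)
Lemma leafless_support_exists : exists q, leafless_support p q.
Proof.
pose q v := if `[< moves v >] then p v else v.
have qp : thinner q p by move=> v; rewrite /q; case: ifP; [right|left].
have qE r v : directed_forest r -> leafless r -> thinner r p -> r v <> v -> q v = r v.
  move=> rf rl rp rv; rewrite /q asboolT; last by exists r.
  by case: (rp v).
exists q; split => //.
- exact: thinner_forest qp.
- move=> v; have [[r [rf rl rp rv]]|nv] := pselect (moves v); last first.
    by exists v; rewrite /q asboolF.
  have [u ru] := rl v; exists u; rewrite (qE r)// ru => vu.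
  by apply: rv; rewrite {1}vu.
- move=> r rf rl rp v; have [|rv] := pselect (r v = v); first by left.
  by right; rewrite (qE r).
Qed.

(** Children for [r] are children for [q], so at most one exists; leaflessness of [r] provides
    one. *)
Lemma thinner_forkless (q r : V -> V) :
  thinner r q -> leafless r -> forkless q -> forkless r.
Proof.
move=> rq rl qf v rv.
have qv : q v = r v by case: (rq v) => // /rv.
have [|u uE] := qf v; first by rewrite /is_root qv.
have sub w : Chi r v w -> w = u.
  move=> [rw vw]; have : Chi q v w.
    by split => //; case: (rq w) => [E|<-//]; case: vw; rewrite -rw E.
  by rewrite uE.
have [w rw] := rl v.
have Cw : Chi r v w by split => // vw; apply: rv; rewrite /is_root {1}vw.
exists u; apply/seteqP; split => [z /sub //|_ ->].
by rewrite -(sub w Cw).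
Qed.

End LeaflessSupport.

(** * From hyponormal squares to forklessness, and the equivalence *)

Lemma square_hyponormal_forkless (R : realType) (V : choiceType) (p q : V -> V) :
  directed_forest q -> leafless q -> thinner q p ->
  (forall lam : V -> R[i], weight_system p lam ->
     bounded_op (Gamma p lam) -> hyponormal (Gamma p lam) ->
     hyponormal (iter 2 (Gamma p lam))) ->
  forkless q.
Proof.
move=> Fq ql qp H v qv.
have [c qc] := choice ql.
have cv : Chi q v (c v) by split => // E; apply: qv; rewrite /is_root {1}E.
(* A child u other than c v would make v a fork, with branches starting at u and c v. *)
exists (c v); apply/seteqP; split => [u Cu|_ -> //]; apply: contrapT => /= ucv.
have := @fork_square_not_hyponormal R V p q c v u (c v) Fq qp qc qv Cu cv ucv.
apply; apply: H.
- exact: (fork_weight_system R qp qc qv Cu cv).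
- exact: (fork_bounded R Fq qp qc qv Cu cv ucv).
- exact: (fork_hyponormal R Fq qp qc qv Cu cv ucv).
Qed.

Theorem theorem5p4 (R : realType) (V : choiceType) (p : V -> V)
    (HV : inhabited V) (Hp : directed_forest p) :
  [<->
    (* (a) *)
    (forall lam : V -> R[i], weight_system p lam ->
       bounded_op (Gamma p lam) -> hyponormal (Gamma p lam) ->
       power_hyponormal (Gamma p lam));
    (* (b) *)
    (forall lam : V -> R[i], weight_system p lam ->
       bounded_op (Gamma p lam) -> hyponormal (Gamma p lam) ->
       hyponormal (iter 2 (Gamma p lam)));
    (* (c) *)
    (exists q : V -> V, leafless_support p q /\ forkless q);
    (* (d) *)
    (forall q : V -> V, directed_forest q -> leafless q -> thinner q p ->
       forkless q)].
Proof.
tfae.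
- by move=> H lam ws bT hT; apply: H.
- move=> H; have [q qs] := leafless_support_exists Hp; exists q; split=> //.
  by case: qs => Fq ql qp _; exact: square_hyponormal_forkless H.
(* By maximality every leafless forest thinner than [p] is thinner than the support. *)
- move=> [q [[Fq ql qp qmax] qf]] r Fr rl rp.
  exact: thinner_forkless (qmax r Fr rl rp) rl qf.
- by move=> H lam; exact: forkless_power_hyponormal.
Qed.
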